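(* Let $Y$ be an infinite dimensional real Hilbert space and $A:\ell^2\to Y$ an injective bounded linear operator with non-closed range. Let $x^\dagger\in\ell^1\setminus\ell^0$ and $\eta>0$. Then for every $v\in Y$ the condition $A^*v\in\partial\mathcal{R}_\eta(x^\dagger)$ fails. Moreover, for $\xi^\dagger\in\partial\mathcal{R}_\eta(x^\dagger)$, it does not hold that $d_{\xi^\dagger}(R)\to0$ as $R\to\infty$, where $$d_{\xi^\dagger}(R):=\inf_{v\in Y:\ \|v\|_Y\le R}\|\xi^\dagger-A^*v\|_{\ell^\infty},\qquad R>0 .$$
   Context: Sequence spaces are real; $\ell^0$ denotes the set of sequences with only finitely many nonzero components. $A^*:Y\to\ell^2$ is the Hilbert space adjoint of $A$, and $\ell^2\subset\ell^\infty$. For $\eta>0$, $\mathcal{R}_\eta(x):=\eta\|x\|_{\ell^1}+\frac12\|x\|_{\ell^2}^2$ is a convex functional on $\ell^1$, and its subdifferential $\partial\mathcal{R}_\eta(x)\subset(\ell^1)^*=\ell^\infty$ at $x\in\ell^1$ consists of all $\xi=\{\xi_k\}_{k=1}^\infty$ of the form $\xi_k=\eta\,\zeta_k+x_k$ with $\zeta_k=1$ if $x_k>0$, $\zeta_k=-1$ if $x_k<0$, and $\zeta_k\in[-1,1]$ if $x_k=0$. *)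

(* Defs.v *)
From HB Require Import structures.
From mathcomp Require Import all_boot all_order all_algebra.
From mathcomp Require Import all_classical all_reals all_analysis.
From mathcomp Require Import ring lra.
Import Order.TTheory GRing.Theory Num.Theory.
Import numFieldNormedType.Exports.

Set Implicit Arguments.
Unset Strict Implicit.
Unset Printing Implicit Defensive.

Local Open Scope classical_set_scope.
Local Open Scope ring_scope.

HB.mixin Record NormedModule_hasInner (R : realType) V & NormedModule R V := {
  inner : V -> V -> R ;
  innerC : forall x y, inner x y = inner y x ;
  innerDl : forall x y z, inner (x + y) z = inner x z + inner y z ;
  innerZl : forall (a : R) x y, inner (a *: x) y = a * inner x y ;
  inner_norm : forall x, inner x x = `|x| ^+ 2
}.

#[short(type="hilbertType")]
HB.structure Definition Hilbert (R : realType) :=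
  {V of CompleteNormedModule R V & NormedModule_hasInner R V}.

Definition infinite_dimensional (R : realType) (V : lmodType R) :=
  forall (n : nat) (e : 'I_n -> V),
    exists v : V, forall c : 'I_n -> R, v <> \sum_(i < n) c i *: e i.

Definition bounded_operator (R : realType) (U V : normedModType R)
    (f : U -> V) :=
  exists M : R, forall x, `|f x| <= M * `|x|.

(* Sequences are indexed from 0. *)
Section sequence_spaces.
Context {R : realType}.
Implicit Types x y : nat -> R.

Definition ell0 : set (nat -> R) :=
  [set x : nat -> R | finite_set [set k | x k != 0]].

Definition ell1 : set (nat -> R) :=
  [set x : nat -> R | cvgn (series (fun k => `|x k|))].

Definition ell2 : set (nat -> R) :=
  [set x : nat -> R | cvgn (series (fun k => x k ^+ 2))].

Definition ellinf : set (nat -> R) :=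
  [set x : nat -> R | has_ubound (range (fun k => `|x k|))].

(* These norms are junk values outside the corresponding space. *)
Definition norm1 x : R := limn (series (fun k => `|x k|)).

Definition norm2 x : R := Num.sqrt (limn (series (fun k => x k ^+ 2))).

Definition norminf x : R := sup (range (fun k => `|x k|)).

End sequence_spaces.

Section ell2_lemmas.
Context {R : realType}.
Implicit Types x y : nat -> R.

Lemma cvg_ell2M x y : ell2 x -> ell2 y -> cvgn (series (fun k => x k * y k)).
Proof.
move=> cx cy; apply: normed_cvg.
have c : cvgn (series (fun k => x k ^+ 2 + y k ^+ 2)).
  exact: (is_cvg_seriesD cx cy).
apply: series_le_cvg c => n //=; first by rewrite addr_ge0// sqr_ge0.
rewrite normrM -(real_normK (num_real (x n))) -(real_normK (num_real (y n))).
have := sqr_ge0 (`|x n| - `|y n|); have := mulr_ge0 (normr_ge0 (x n)) (normr_ge0 (y n)).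
rewrite sqrrB mulr2n => h1 h2; lra.
Qed.

Lemma ell2_submod_closed : submod_closed [pred x : nat -> R | `[< ell2 x >]].
Proof.
split.
  apply/asboolP; rewrite /ell2/=.
  rewrite (_ : series _ = fun=> 0); first exact: is_cvg_cst.
  by apply/funext => n; rewrite /series/= big1// => i _; rewrite expr0n.
move=> a x y /asboolP cx /asboolP cy; apply/asboolP; rewrite /ell2/=.
rewrite (_ : (fun k => _) = (a ^+ 2) *: (fun k => x k ^+ 2) +
   ((a * 2) *: (fun k => x k * y k) + fun k => y k ^+ 2)).
  apply: is_cvg_seriesD; first exact: is_cvg_seriesZ.
  apply: is_cvg_seriesD => //; apply: is_cvg_seriesZ; exact: cvg_ell2M.
apply/funext => k.
rewrite -[LHS]/((a * x k + y k) ^+ 2).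
rewrite -[RHS]/(a ^+ 2 * x k ^+ 2 + (a * 2 * (x k * y k) + y k ^+ 2)).
by ring.
Qed.

HB.instance Definition _ := GRing.isSubmodClosed.Build R (nat -> R)
  [pred x : nat -> R | `[< ell2 x >]] ell2_submod_closed.

End ell2_lemmas.

Record l2 (R : realType) := L2 {
  l2_seq :> nat -> R ;
  l2_seqP : [pred x : nat -> R | `[< ell2 x >]] l2_seq }.

HB.instance Definition _ (R : realType) := [isSub for @l2_seq R].
HB.instance Definition _ (R : realType) := [Choice of l2 R by <:].
HB.instance Definition _ (R : realType) :=
  [SubChoice_isSubLmodule of l2 R by <:].

Section l2_hilbert.
Context {R : realType}.
Implicit Types x y z : l2 R.

Lemma l2P x : ell2 x.
Proof. exact/asboolP/l2_seqP. Qed.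
Arguments l2P : clear implicits.

Lemma l2D x y k : (x + y) k = x k + y k.
Proof. by []. Qed.

Lemma l2B x y k : (x - y) k = x k - y k.
Proof. by []. Qed.

Lemma l2Z (a : R) x k : (a *: x) k = a * x k.
Proof. by []. Qed.

Lemma l2_eqP x y : x =1 y -> x = y.
Proof. by move=> xy; apply/val_inj/funext. Qed.

Definition l2_inner x y : R := limn (series (fun k => x k * y k)).

Lemma l2_innerC x y : l2_inner x y = l2_inner y x.
Proof. by congr (limn (series _)); apply/funext => k; rewrite mulrC. Qed.

Lemma l2_innerDl x y z : l2_inner (x + y) z = l2_inner x z + l2_inner y z.
Proof.
rewrite /l2_inner -lim_seriesD; [|exact/cvg_ell2M/l2P/l2P..].
by congr (limn (series _)); apply/funext => k; rewrite l2D mulrDl.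
Qed.

Lemma l2_innerZl (a : R) x y : l2_inner (a *: x) y = a * l2_inner x y.
Proof.
rewrite /l2_inner -[RHS]lim_seriesZ; last exact/cvg_ell2M/l2P/l2P.
by congr (limn (series _)); apply/funext => k; rewrite l2Z -mulrA.
Qed.

Lemma ell2_partial (u : nat -> R) n : ell2 u ->
  series (fun k => u k ^+ 2) n <= limn (series (fun k => u k ^+ 2)).
Proof.
move=> cu; apply: nondecreasing_cvgn_le => //.
by apply: nondecreasing_series => k _ _; exact: sqr_ge0.
Qed.

Lemma l2_innerxxE x : l2_inner x x = limn (series (fun k => x k ^+ 2)).
Proof. by []. Qed.

Lemma l2_innerxx_ge0 x : 0 <= l2_inner x x.
Proof.
rewrite l2_innerxxE; apply: le_trans (ell2_partial 0 (l2P x)).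
by rewrite /series/= big_geq.
Qed.

Lemma norm2_sqr x : norm2 x ^+ 2 = l2_inner x x.
Proof. by rewrite sqr_sqrtr -?l2_innerxxE ?l2_innerxx_ge0. Qed.

Lemma l2_coord x k : `|x k| <= norm2 x.
Proof.
rewrite -ler_sqr ?nnegrE ?sqrtr_ge0// norm2_sqr real_normK ?num_real//.
rewrite l2_innerxxE; apply: le_trans (ell2_partial k.+1 (l2P x)).
by rewrite seriesSr lerDr sumr_ge0// => i _; exact: sqr_ge0.
Qed.

Lemma l2_cauchy_schwarz x y : l2_inner x y <= norm2 x * norm2 y.
Proof.
have h (a b : R) : 0 <= a ^+ 2 * l2_inner x x - 2 * a * b * l2_inner x y
    + b ^+ 2 * l2_inner y y.
  have := l2_innerxx_ge0 (a *: x - b *: y).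
  rewrite -scaleNr l2_innerDl !l2_innerZl.
  rewrite !(l2_innerC _ (_ + _)) !l2_innerDl !l2_innerZl.
  rewrite (l2_innerC y x) => hh; lra.
have [x0|xn0] := eqVneq (norm2 x) 0.
  have : x = 0.
    by apply: l2_eqP => k; apply/eqP; rewrite -normr_le0 -x0 l2_coord.
  by move=> ->; rewrite -(scale0r 0) l2_innerZl mul0r mulr_ge0 ?sqrtr_ge0.
have [y0|yn0] := eqVneq (norm2 y) 0.
  have : y = 0.
    by apply: l2_eqP => k; apply/eqP; rewrite -normr_le0 -y0 l2_coord.
  by move=> ->; rewrite l2_innerC -(scale0r 0) l2_innerZl mul0r mulr_ge0 ?sqrtr_ge0.
have xp : 0 < norm2 x by rewrite lt0r xn0 sqrtr_ge0.
have yp : 0 < norm2 y by rewrite lt0r yn0 sqrtr_ge0.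
have := h (norm2 y) (norm2 x); rewrite -!norm2_sqr => hh.
have xyp := mulr_gt0 xp yp.
rewrite -(ler_pM2l xyp); lra.
Qed.

Let nm x : R := norm2 x.

Lemma l2_ler_normD x y : nm (x + y) <= nm x + nm y.
Proof.
rewrite -ler_sqr ?nnegrE ?addr_ge0 ?sqrtr_ge0//.
rewrite sqrrD !norm2_sqr l2_innerDl !(l2_innerC _ (_ + _)) !l2_innerDl.
rewrite (l2_innerC y x); have := l2_cauchy_schwarz x y.
rewrite /nm mulr2n => ?; lra.
Qed.

Lemma l2_normrZ (a : R) x : nm (a *: x) = `|a| * nm x.
Proof.
apply/eqP; rewrite -(@eqrXn2 _ 2%N) ?mulr_ge0 ?sqrtr_ge0//; apply/eqP.
rewrite exprMn !norm2_sqr real_normK ?num_real//.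
by rewrite l2_innerZl l2_innerC l2_innerZl mulrA.
Qed.

Lemma l2_normr0_eq0 x : nm x = 0 -> x = 0.
Proof.
move=> x0; apply: l2_eqP => k.
by apply/eqP; rewrite -normr_le0 -x0 l2_coord.
Qed.

HB.instance Definition _ := Lmodule_isNormed.Build R (l2 R)
  l2_ler_normD l2_normrZ l2_normr0_eq0.

Lemma l2_normE x : `|x| = norm2 x.
Proof. by []. Qed.

Lemma l2_inner_norm x : l2_inner x x = `|x| ^+ 2.
Proof. by rewrite l2_normE norm2_sqr. Qed.

Lemma l2_complete (F : set_system (l2 R)) :
  ProperFilter F -> cauchy F -> cvg F.
Proof.
move=> FF Fc.
have cF (e : R) : 0 < e -> exists x, F (ball x e).
  by move=> e0; move/cauchyP : Fc; apply.
have cvk k : cvg ((fun x : l2 R => x k) x @[x --> F]).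
  apply: (@cauchy_cvg R); apply/cauchy_exP => e /= e0.
  have [x Fx] := cF e e0; exists (x k); rewrite /nbhs/=.
  apply: filterS Fx => y; rewrite -!ball_normE/= => xy.
  by rewrite -l2B (le_lt_trans (l2_coord _ _)).
pose a k : R := lim ((fun x : l2 R => x k) x @[x --> F]).
have key x e : F (ball x e) -> forall n,
    series (fun k => (x k - a k) ^+ 2) n <= e ^+ 2.
  move=> Fx n.
  have h : (fun y : l2 R => series (fun k => (x k - y k) ^+ 2) n) @ F -->
      series (fun k => (x k - a k) ^+ 2) n.
    rewrite /series/=; apply: (@cvg_big R _ +%R 0 xpredT).
      by move=> p; exact: add_continuous.
    by move=> k _; apply: cvgM; apply: cvgB; (try exact: cvg_cst); exact: cvk.
  apply: (cvgr_to_le h); apply: filterS Fx => y. rewrite -ball_normE/= => xy.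
  apply: le_trans (ell2_partial n (l2P (x - y))) _.
  by rewrite -l2_innerxxE l2_inner_norm lerXn2r ?nnegrE// ltW// (le_lt_trans _ xy).
have a2 x e : F (ball x e) -> ell2 (fun k => x k - a k).
  move=> Fx; apply: nondecreasing_is_cvgn.
    by apply: nondecreasing_series => k _ _; exact: sqr_ge0.
  by exists (e ^+ 2) => _ [n _ <-]; exact: key Fx n.
have [x0 Fx0] := cF 1 ltr01.
pose w := L2 (asboolT (a2 _ _ Fx0)).
pose l := x0 - w.
have lE k : l k = a k by rewrite /l l2B/= opprB addrC subrK.
apply/cvg_ex; exists l; apply/cvgrPdist_le => /= e e0.
have [x Fx] := cF _ (divr_gt0 e0 (ltr0n _ 2)).
have xl : `|x - l| <= e / 2.
  rewrite -ler_sqr ?nnegrE ?divr_ge0 ?(ltW e0)// -l2_inner_norm l2_innerxxE.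
  apply: limr_le; first exact: (l2P (x - l)).
  near=> n; apply: le_trans (key _ _ Fx n).
  by rewrite /series/=; under [leRHS]eq_bigr do rewrite -lE.
apply: filterS Fx => y; rewrite -ball_normE/= => xy.
rewrite -(subrK x l) -addrA (le_trans (ler_normD _ _))// [e]splitr.
by rewrite distrC in xl; rewrite lerD// ltW.
Unshelve. all: by end_near. Qed.

HB.instance Definition _ := Uniform_isComplete.Build (l2 R) l2_complete.

HB.instance Definition _ := NormedModule_hasInner.Build R (l2 R)
  l2_innerC l2_innerDl l2_innerZl l2_inner_norm.

End l2_hilbert.
Arguments l2P {R} x.

(* For bounded A on l2 the defining identity is lemma adjointP below; [xget]
   only makes the definition total. *)
Definition adjoint (R : realType) (H Y : hilbertType R) (A : H -> Y) (v : Y) :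
    H :=
  xget 0 [set w | forall x, inner x w = inner (A x) v].

Section inner_theory.
Context {R : realType} {H : hilbertType R}.
Implicit Types x y z : H.

Lemma innerDr x y z : inner x (y + z) = inner x y + inner x z.
Proof. by rewrite innerC innerDl !(innerC x). Qed.

Lemma innerZr (a : R) x y : inner x (a *: y) = a * inner x y.
Proof. by rewrite innerC innerZl (innerC x). Qed.

Lemma inner0l x : inner 0 x = 0.
Proof. by rewrite -(scale0r 0) innerZl mul0r. Qed.

Lemma innerNl x y : inner (- x) y = - inner x y.
Proof. by rewrite -scaleN1r innerZl mulN1r. Qed.

Lemma innerBl x y z : inner (x - y) z = inner x z - inner y z.
Proof. by rewrite innerDl innerNl. Qed.

Lemma inner_suml (n : nat) (F : nat -> H) y :
  inner (\sum_(0 <= i < n) F i) y = \sum_(0 <= i < n) inner (F i) y.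
Proof.
elim: n => [|n ih]; first by rewrite !big_geq// inner0l.
by rewrite !big_nat_recr//= innerDl ih.
Qed.

Lemma inner_cauchy_schwarz x y : inner x y <= `|x| * `|y|.
Proof.
have [->|xn0] := eqVneq x 0; first by rewrite inner0l normr0 mul0r.
have [->|yn0] := eqVneq y 0; first by rewrite innerC inner0l normr0 mulr0.
have xp : 0 < `|x| by rewrite normr_gt0.
have yp : 0 < `|y| by rewrite normr_gt0.
have := sqr_ge0 `|(`|y| *: x) - (`|x| *: y)|.
rewrite -inner_norm innerBl !innerZl !(innerC _ (_ - _)) !innerBl !innerZl.
rewrite (innerC y x) !inner_norm => h.
rewrite -(ler_pM2l (mulr_gt0 xp yp)); lra.
Qed.

End inner_theory.

Section adjoint_l2.
Context {R : realType}.

Lemma series_single (u : nat -> R) k : (forall j, j != k -> u j = 0) ->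
  series u @ \oo --> u k.
Proof.
move=> uk; apply: cvg_near_cst; exists k.+1 => // n /= kn.
rewrite /series/= big_mkord (bigD1 (Ordinal kn))//= big1 ?addr0//.
by move=> i ik; apply: uk; rewrite -val_eqE in ik.
Qed.

Definition delta (k j : nat) : R := (j == k)%:R.

Lemma ell2_delta k : ell2 (delta k).
Proof.
apply/cvg_ex; exists (delta k k ^+ 2).
apply: (@series_single (fun j => delta k j ^+ 2)) => j jk.
by rewrite /delta (negbTE jk) expr0n.
Qed.

Definition l2_delta k : l2 R := L2 (asboolT (@ell2_delta k)).

Lemma inner_delta (x : l2 R) k : inner x (l2_delta k) = x k.
Proof.
apply/cvg_lim => //.
rewrite [in X in _ --> X](_ : x k = x k * delta k k).
  apply: (@series_single (fun j => x j * delta k j)) => j jk.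
  by rewrite /delta (negbTE jk) mulr0.
by rewrite /delta eqxx mulr1.
Qed.

Definition l2_trunc (u : nat -> R) n : l2 R :=
  \sum_(0 <= i < n) u i *: l2_delta i.

Lemma inner_trunc u n (y : l2 R) :
  inner (l2_trunc u n) y = series (fun k => u k * y k) n.
Proof.
rewrite inner_suml; apply: eq_bigr => i _.
by rewrite innerZl innerC inner_delta.
Qed.

Lemma l2_truncE u n k : l2_trunc u n k = if (k < n)%N then u k else 0.
Proof.
rewrite -inner_delta inner_trunc /series/=.
case: ifPn => kn.
  rewrite big_mkord (bigD1 (Ordinal kn))//= /delta eqxx mulr1 big1 ?addr0//.
  by move=> i; rewrite -val_eqE/= => /negbTE->; rewrite mulr0.
rewrite big_nat big1// => i /andP[_ iN]; rewrite /delta.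
by case: eqP => [ik|]; [rewrite -ik iN in kn|rewrite mulr0].
Qed.

Lemma norm_trunc u n : `|l2_trunc u n| ^+ 2 = series (fun k => u k ^+ 2) n.
Proof.
rewrite -inner_norm inner_trunc /series/= !big_nat; apply: eq_bigr => i /andP[_ iN].
by rewrite l2_truncE iN.
Qed.

Lemma cvg_trunc (x : l2 R) : l2_trunc x n @[n --> \oo] --> x.
Proof.
apply/cvgrPdist_le => /= e e0.
have := l2P x; rewrite /ell2/= -/(l2_inner x x) => /cvgrPdist_le /(_ (e ^+ 2) (exprn_gt0 _ e0)).
apply: filterS => n /= h.
rewrite -ler_sqr ?nnegrE// ?(ltW e0)//; apply: le_trans h.
rewrite -inner_norm innerBl !(innerC _ (_ - _)) !innerBl !inner_norm norm_trunc.
rewrite (innerC x) inner_trunc -l2_inner_norm subrr subr0; exact: ler_norm.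
Qed.

Lemma adjointP (Y : hilbertType R) (A : {linear l2 R -> Y}) :
  bounded_operator A ->
  forall x v, inner x (adjoint A v) = inner (A x) v.
Proof.
move=> [M AM] x v; move: x.
rewrite /adjoint; case: xgetP => [w -> //|noadj].
pose w k : R := inner (A (l2_delta k)) v.
have innerAtrunc u n : inner (A (l2_trunc u n)) v = series (fun k => u k * w k) n.
  rewrite /l2_trunc linear_sum inner_suml; apply: eq_bigr => i _.
  by rewrite linearZ innerZl.
have wbound n : series (fun k => w k ^+ 2) n <= (M * `|v|) ^+ 2.
  have := inner_cauchy_schwarz (A (l2_trunc w n)) v.
  rewrite innerAtrunc -[X in X <= _]/(series (fun k => w k ^+ 2) n) -norm_trunc.
  have := ler_wpM2r (normr_ge0 v) (AM (l2_trunc w n)).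
  move: `|l2_trunc w n| (normr_ge0 (l2_trunc w n)) => s s0 h1 h2.
  have [->|sn0] := eqVneq s 0; first by rewrite expr0n sqr_ge0.
  have sp : 0 < s by rewrite lt0r sn0.
  have sM : s <= M * `|v|.
    by rewrite -(ler_pM2l sp); have := le_trans h2 h1; rewrite expr2 => ?; lra.
  by rewrite lerXn2r ?nnegrE// (le_trans s0).
have cw : ell2 w.
  apply: nondecreasing_is_cvgn.
    by apply: nondecreasing_series => k _ _; exact: sqr_ge0.
  by exists ((M * `|v|) ^+ 2) => _ [n _ <-].
exfalso; apply: (noadj (L2 (asboolT cw))) => x /=.
have cA : {for x, continuous A}.
  apply: bounded_linear_continuous; apply/linear_boundedP.
  exists M; split; first exact: num_real.
  by move=> r Mr y; rewrite (le_trans (AM y))// ler_wpM2r// ltW.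
have h1 : A (l2_trunc x n) @[n --> \oo] --> A x.
  by apply: continuous_cvg => //; exact: cvg_trunc.
have h2 : series (fun k => x k * w k) @ \oo --> inner (A x) v.
  apply/cvgrPdist_le => /= e e0.
  have v1 : 0 < `|v| + 1 by rewrite ltr_wpDl.
  move/cvgrPdist_le : h1 => /(_ (e / (`|v| + 1)) (divr_gt0 e0 v1)).
  apply: filterS => n /= h; rewrite -innerAtrunc -innerBl.
  have ev : `|A x - A (l2_trunc x n)| * `|v| <= e.
    by rewrite -[e](divfK (lt0r_neq0 v1)) ler_pM// lerDl.
  rewrite ler_norml lerNl -innerNl; apply/andP; split;
    rewrite (le_trans (inner_cauchy_schwarz _ _)) ?normrN//.
exact/cvg_lim.
Qed.

End adjoint_l2.

Section subdifferential.
Context {R : realType}.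
Implicit Types x z xi zeta : nat -> R.

(* The pairing through which ellinf is the dual of ell1. *)
Definition ell1_pairing xi z : R := limn (series (fun k => xi k * z k)).

Definition subdifferential (F : (nat -> R) -> R) x : set (nat -> R) :=
  [set xi : nat -> R | ellinf xi /\
    forall z, ell1 z -> F x + ell1_pairing xi (fun k => z k - x k) <= F z].

(* eta * |x|_1 + |x|_2^2 / 2; lemma subdifferential_Reg below gives the
   componentwise description of its subdifferential. *)
Definition Reg (eta : R) x : R := eta * norm1 x + norm2 x ^+ 2 / 2.

Lemma ell1_ellinf x : ell1 x -> ellinf x.
Proof.
move=> /[dup] c /cvg_lim; exists (norm1 x) => _ [k _ <-].
have : series (fun k => `|x k|) k.+1 <= norm1 x.
  apply: nondecreasing_cvgn_le => //.
  exact: nondecreasing_series.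
by apply: le_trans; rewrite seriesSr lerDr sumr_ge0.
Qed.

Lemma ellinf_ub xi : ellinf xi -> exists2 M, 0 <= M & forall k, `|xi k| <= M.
Proof.
move=> [M hM]; exists M => [|k]; last by apply: hM; exists k.
by apply: le_trans (normr_ge0 (xi 0%N)) _; apply: hM; exists 0%N.
Qed.

Lemma cvg_pairing xi x : ellinf xi -> ell1 x -> cvgn (series (fun k => xi k * x k)).
Proof.
move=> /ellinf_ub[M M0 hM] cx; apply: normed_cvg.
have c : cvgn (series (fun k => M * `|x k|)) by exact: is_cvg_seriesZ.
by apply: series_le_cvg c => n //=; rewrite ?mulr_ge0// normrM ler_wpM2r.
Qed.

Lemma ell1_ell2 x : ell1 x -> ell2 x.
Proof. by move=> cx; apply: cvg_pairing => //; exact: ell1_ellinf. Qed.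

Lemma ell1D x z : ell1 x -> ell1 z -> ell1 (fun k => x k + z k).
Proof.
move=> cx cz.
have c : cvgn (series (fun k => `|x k| + `|z k|)) by exact: (is_cvg_seriesD cx cz).
by apply: series_le_cvg c => n //=; rewrite ?addr_ge0// ler_normD.
Qed.

Lemma ell1N x : ell1 x -> ell1 (fun k => - x k).
Proof.
rewrite /ell1/=; set u := fun k => `|- x k|.
by rewrite (_ : u = fun k => `|x k|)//; apply/funext => k; rewrite /u normrN.
Qed.

Lemma ell1_delta (t : R) k : ell1 (fun j => t * delta k j).
Proof.
apply/cvg_ex; exists `|t * delta k k|.
apply: (@series_single _ (fun j => `|t * delta k j|)) => j jk.
by rewrite /delta (negbTE jk) mulr0 normr0.
Qed.

Definition Reg_term (eta : R) (a : R) : R := eta * `|a| + a ^+ 2 / 2.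

Lemma cvg_Reg eta x : ell1 x ->
  series (fun k => Reg_term eta (x k)) @ \oo --> Reg eta x.
Proof.
move=> cx; have c2 := ell1_ell2 cx.
rewrite /Reg sqr_sqrtr; last first.
  apply: limr_ge => //; near=> n; rewrite sumr_ge0// => i _; exact: sqr_ge0.
rewrite (_ : series (fun k => Reg_term eta (x k)) = fun n =>
  eta * series (fun k => `|x k|) n + series (fun k => x k ^+ 2) n / 2).
  have h1 : eta * series (fun k => `|x k|) n @[n --> \oo] --> eta * norm1 x.
    by apply: cvgM; [exact: cvg_cst|exact: cx].
  have h2 : series (fun k => x k ^+ 2) n / 2 @[n --> \oo] -->
      limn (series (fun k => x k ^+ 2)) / 2.
    by apply: cvgM; [exact: c2|exact: cvg_cst].
  exact: cvgD h1 h2.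
apply/funext => n; rewrite /series/= mulr_sumr mulr_suml -big_split.
exact: eq_bigr.
Unshelve. all: by end_near. Qed.

Arguments cvg_Reg : clear implicits.

Lemma Reg_slope (eta a g : R) : 0 < eta ->
  (forall t : R, Reg_term eta a + g * t <= Reg_term eta (a + t)) <->
  exists s : R, g = eta * s + a /\
    [/\ 0 < a -> s = 1, a < 0 -> s = -1 & a = 0 -> -1 <= s <= 1].
Proof.
move=> eta0; rewrite /Reg_term; split.
  move=> h; exists ((g - a) / eta); split.
    by rewrite mulrC divfK ?lt0r_neq0// subrK.
  split=> [a0|a0|a0].
  - suff : g - a = eta by move=> ->; rewrite divff ?lt0r_neq0.
    apply/eqP; rewrite -subr_eq0; apply/negPn/negP => c0.
    pose c := g - a - eta.
    have hh (t : R) : - a <= t -> c * t <= t ^+ 2 / 2.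
      move=> ta; have := h t; rewrite (ger0_norm (ltW a0)) ger0_norm; last lra.
      rewrite /c sqrrD => ?; nra.
    have [cp|cn] := ltP 0 c.
      have := hh c ltac:(lra); have := mulr_gt0 cp cp; rewrite expr2 => ? ?; nra.
    have cn' : c < 0 by rewrite lt_neqAle c0.
    have [ca|ca] := leP (- a) c.
      have := hh c ca; have := mulr_gt0 (x := - c) (y := - c).
      rewrite expr2 mulrNN oppr_gt0 => /(_ cn' cn') ? ?; nra.
    have := hh (- a) (lexx _); have : (- a - c) * a > 0 by rewrite mulr_gt0// subr_gt0.
    by have := mulr_gt0 a0 a0; rewrite expr2 => ? ? ?; nra.
  - suff : g - a = - eta by move=> ->; rewrite mulNr divff ?lt0r_neq0.
    apply/eqP; rewrite -subr_eq0; apply/negPn/negP => c0.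
    pose c := g - a + eta.
    have c0' : c != 0 by rewrite /c; rewrite opprK in c0.
    have hh (t : R) : t <= - a -> c * t <= t ^+ 2 / 2.
      move=> ta; have := h t; rewrite (ler0_norm (ltW a0)) ler0_norm; last lra.
      rewrite /c sqrrD => ?; nra.
    have [cp|cn] := ltP c 0.
      have := hh c ltac:(lra); have := mulr_gt0 (x := - c) (y := - c).
      rewrite expr2 mulrNN oppr_gt0 => /(_ cp cp) ? ?; nra.
    have cn' : 0 < c by rewrite lt_neqAle eq_sym c0'.
    have [ca|ca] := leP c (- a).
      have := hh c ca; have := mulr_gt0 cn' cn'; rewrite expr2 => ? ?; nra.
    have := hh (- a) (lexx _); have : (c + a) * (- a) > 0 by rewrite mulr_gt0; lra.
    have := mulr_gt0 (x := - a) (y := - a).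
    rewrite expr2 mulrNN oppr_gt0 => /(_ a0 a0) ? ? ?; nra.
  - move: h; rewrite a0 subr0 => h.
    have hh (t : R) : 0 <= t -> (`|g| - eta) * t <= t ^+ 2 / 2.
      move=> t0; have := h t; have := h (- t).
      rewrite !add0r normr0 expr0n/= sqrrN normrN ger0_norm//.
      by case: (ger0P g) => ? ? ?; nra.
    have : `|g| <= eta.
      rewrite leNgt; apply/negP => ge; have gp : 0 < `|g| - eta by lra.
      by have := hh _ (ltW gp); have := mulr_gt0 gp gp; rewrite expr2 => ? ?; nra.
    rewrite ler_norml => /andP[g1 g2].
    by rewrite ler_pdivlMr// ler_pdivrMr// mulN1r mul1r g1 g2.
move=> [s [-> [sp sn s0]]] t.
have h : eta * `|a| + eta * s * t <= eta * `|a + t|.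
  rewrite -mulrA -mulrDr ler_pM2l//.
  have [ap|an|a0] := ltgtP 0 a.
  - by rewrite (sp ap) mul1r gtr0_norm// ler_norm.
  - by rewrite (sn an) mulN1r ltr0_norm// -opprD -normrN ler_norm.
  - rewrite -a0 normr0 !add0r; move: (s0 (esym a0)) => /andP[s1 s2].
    apply: le_trans (ler_norm _) _; rewrite normrM -[leRHS]mul1r ler_wpM2r//.
    by rewrite ler_norml s1.
by have := sqr_ge0 t; rewrite sqrrD => ?; nra.
Qed.

Lemma subdifferential_Reg (eta : R) x : 0 < eta -> ell1 x ->
  subdifferential (Reg eta) x =
  [set xi | exists zeta, forall k, xi k = eta * zeta k + x k /\
    [/\ 0 < x k -> zeta k = 1, x k < 0 -> zeta k = -1 &
        x k = 0 -> -1 <= zeta k <= 1]].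
Proof.
move=> eta0 cx; apply/seteqP; split => xi /=.
  move=> [xiinf h].
  suff /choice[zeta hz] : forall k, exists s : R, xi k = eta * s + x k /\
    [/\ 0 < x k -> s = 1, x k < 0 -> s = -1 & x k = 0 -> -1 <= s <= 1].
    by exists zeta.
  move=> k; apply/(Reg_slope _ _ eta0) => t.
  pose z j := x j + t * delta k j.
  have cz : ell1 z by apply: ell1D => //; exact: ell1_delta.
  have := h z cz.
  rewrite (_ : ell1_pairing _ _ = xi k * t); last first.
    apply/cvg_lim => //.
    rewrite [X in _ --> X](_ : _ = xi k * (z k - x k)); last first.
      by rewrite /z addrC addKr /delta eqxx mulr1.
    apply: (@series_single _ (fun j => xi j * (z j - x j))) => j jk.
    by rewrite /z addrC addKr /delta (negbTE jk) !mulr0.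
  rewrite -lerBrDl => hk.
  suff E : Reg eta z - Reg eta x = Reg_term eta (x k + t) - Reg_term eta (x k).
    by rewrite -lerBrDl -E.
  have d : series (fun j => Reg_term eta (z j) - Reg_term eta (x j)) @ \oo -->
      Reg eta z - Reg eta x.
    rewrite (_ : series _ = series (fun j => Reg_term eta (z j)) -
        series (fun j => Reg_term eta (x j))); last first.
      by apply/funext => n; rewrite /series/= sumrB.
    exact: cvgB (cvg_Reg eta _ cz) (cvg_Reg eta _ cx).
  have d' : series (fun j => Reg_term eta (z j) - Reg_term eta (x j)) @ \oo -->
      Reg_term eta (z k) - Reg_term eta (x k).
    apply: (@series_single _ (fun j => Reg_term eta (z j) - Reg_term eta (x j))).
    by move=> j jk; rewrite /z /delta (negbTE jk) mulr0 addr0 subrr.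
  have -> := cvg_unique _ d d'; first by rewrite /z /delta eqxx mulr1.
  exact: norm_hausdorff.
move=> [zeta hz].
have xiinf : ellinf xi.
  have [M M0 hM] := ellinf_ub (ell1_ellinf cx).
  exists (eta + M) => _ [k _ <-]; have [-> [sp sn s0]] := hz k.
  rewrite (le_trans (ler_normD _ _))// lerD// normrM gtr0_norm//.
  rewrite -[leRHS]mulr1 ler_pM2l//.
  have [ap|an|a0] := ltgtP 0 (x k).
  - by rewrite (sp ap) normr1.
  - by rewrite (sn an) normrN1.
  - by rewrite ler_norml s0.
split=> // z cz.
rewrite -lerBrDl -[X in _ <= X](cvg_lim _ (cvgB (cvg_Reg eta _ cz) (cvg_Reg eta _ cx)))//.
apply: ler_lim.
- by apply: cvg_pairing => //; apply: ell1D => //; exact: ell1N.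
- by apply/cvg_ex; eexists; exact: cvgB (cvg_Reg eta _ cz) (cvg_Reg eta _ cx).
near=> n; rewrite -[leRHS]/(series (fun k => Reg_term eta (z k)) n -
  series (fun k => Reg_term eta (x k)) n) /series/= -sumrB; apply: ler_sum => k _.
rewrite lerBrDl; have := (Reg_slope (x k) (xi k) eta0).2 (ex_intro _ _ (hz k)) (z k - x k).
by rewrite [x k + _]addrC subrK.
Unshelve. all: by end_near. Qed.

End subdifferential.

Definition distance_function (R : realType) (Y : hilbertType R)
    (A : l2 R -> Y) (xi : nat -> R) (r : R) : R :=
  inf [set norminf (fun k => xi k - adjoint A v k) | v in [set v | `|v| <= r]].

(* Main.v *)
(* Where x k <> 0, a subgradient xi satisfies |xi k| = eta + |x k| >= eta, and
   this happens for infinitely many k since x has infinite support.  Elements of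
   l2, hence all A^* v, tend to 0, so they stay at sup-distance at least eta
   from xi. *)
Require Import Defs.
From mathcomp Require Import all_boot all_order all_algebra.
From mathcomp Require Import all_classical all_reals all_analysis.
From mathcomp Require Import lra.
Import Order.TTheory GRing.Theory Num.Theory.
Import numFieldNormedType.Exports.

Set Implicit Arguments.
Unset Strict Implicit.
Unset Printing Implicit Defensive.

Local Open Scope classical_set_scope.
Local Open Scope ring_scope.

(** The squares are the terms of a convergent series, so they eventually drop below [e ^+ 2]. *)
Lemma l2_cvg0 (R : realType) (w : l2 R) : w k @[k --> \oo] --> (0 : R).
Proof.
apply/cvgr0Pnorm_le => e e0.
have /cvgr0Pnorm_le/(_ _ (exprn_gt0 2 e0)) := cvg_series_cvg_0 (l2P w).
by apply: filterS => k; rewrite normrX ler_sqr ?nnegrE ?(ltW e0).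
Qed.

(** Otherwise the support would lie in the finite set [I_N]. *)
Lemma nell0_unbounded_support (R : realType) (x : nat -> R) (N : nat) :
  ~ ell0 x -> exists2 k, (N <= k)%N & x k != 0.
Proof.
move=> xn; apply: contrapT => noK; apply: xn.
apply: (@sub_finite_set _ _ `I_N); last exact: finite_II.
move=> k /= xk; rewrite ltnNge; apply/negP => Nk.
by apply: noK; exists k.
Qed.

(** The summands [eta * zeta k] and [x k] have the same sign, so they cannot cancel. *)
Lemma subgradient_norm_ge (R : realType) (eta : R) (x xi : nat -> R) k :
  0 < eta -> ell1 x -> subdifferential (Reg eta) x xi -> x k != 0 ->
  eta <= `|xi k|.
Proof.
move=> eta0 x1; rewrite subdifferential_Reg//= => -[zeta /(_ k)[-> [zp zn _]]].
have [xn|xp|->] := ltgtP (x k) 0; rewrite ?eqxx // => _.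
- by rewrite (zn xn) mulrN1 ler0_norm; lra.
- by rewrite (zp xp) mulr1 ger0_norm; lra.
Qed.

Lemma norminf_ub (R : realType) (u : nat -> R) k :
  ellinf u -> `|u k| <= norminf u.
Proof. by move=> uinf; apply: ub_le_sup => //; exists k. Qed.

Lemma ellinfB (R : realType) (u w : nat -> R) :
  ellinf u -> ellinf w -> ellinf (fun k => u k - w k).
Proof.
move=> /ellinf_ub[M _ uM] /ellinf_ub[N _ wN]; exists (M + N) => _ [k _ <-].
by rewrite (le_trans (ler_normB _ _))// lerD.
Qed.

Lemma subgradient_l2_dist (R : realType) (eta : R) (x xi : nat -> R) (w : l2 R) :
  0 < eta -> ell1 x -> ~ ell0 x -> subdifferential (Reg eta) x xi ->
  eta <= norminf (fun k => xi k - w k).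
Proof.
move=> eta0 x1 x0 xid; apply/ler_addgt0Pl => e e0.
(* The slack [e] absorbs [|w k|] at a support index [k] beyond [N]. *)
have [N _ wN] := cvgr0_norm_le _ (l2_cvg0 w) _ e0.
have [k Nk xk] := nell0_unbounded_support N x0.
(* Boundedness makes [norminf] a genuine supremum instead of a default value. *)
have winf : ellinf w by exists (norm2 w) => _ [j _ <-]; exact: l2_coord.
have := norminf_ub k (ellinfB xid.1 winf).
have := subgradient_norm_ge eta0 x1 xid xk.
have := wN k Nk; have := ler_normD (xi k - w k) (w k); rewrite subrK /= => *; lra.
Qed.

Theorem proposition4 (R : realType) (Y : hilbertType R)
    (A : {linear l2 R -> Y}) (x : nat -> R) (eta : R)
    (Y_infinite : infinite_dimensional Y)
    (A_bounded : bounded_operator A)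
    (A_injective : injective A)
    (A_nonclosed : ~ closed (range A))
    (x_ell1 : ell1 x) (x_nell0 : ~ ell0 x)
    (eta_gt0 : 0 < eta) :
  (forall v : Y, ~ subdifferential (Reg eta) x (adjoint A v)) /\
  (forall xi : nat -> R, subdifferential (Reg eta) x xi ->
    ~ (distance_function A xi r @[r --> +oo] --> (0 : R))).
Proof.
split=> [v vd|xi xid d0].
  (* Comparing the subgradient [adjoint A v] with itself bounds the norm of the zero sequence below
     by [eta]. *)
  have := subgradient_l2_dist (adjoint A v) eta_gt0 x_ell1 x_nell0 vd.
  rewrite /norminf; under eq_fun do rewrite subrr normr0.
  rewrite set_cst ifN ?sup1; last by apply/set0P; exists 0%N.
  by rewrite leNgt eta_gt0.
suff : eta <= 0 by rewrite leNgt eta_gt0.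
apply: (cvgr_to_ge d0); near=> r.
apply: lb_le_inf; last first.
  by move=> _ [v _ <-]; exact: (subgradient_l2_dist _ eta_gt0 x_ell1).
(* The infimum must range over a nonempty set, as [inf set0] is 0; [v = 0] is admissible once
   [0 <= r]. *)
exists (norminf (fun k => xi k - adjoint A 0 k)), 0 => /=.
by rewrite normr0.
Unshelve. all: by end_near. Qed.
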